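(* Let $X$ be a locally compact Hausdorff space, let $A$ be a monotone complete partially ordered algebra with a monotone continuous multiplication, and let $\mu\colon\mathscr B\to\overline{A^+}$ be a regular Borel measure. Let $\pi\colon C_c(X)\to A$ be a positive algebra homomorphism. (1) Suppose that $\mu(V)=\sup\{\pi(f):f\prec V\}$ for every open subset $V$ of $X$ with finite measure. Then $\mu$ is a spectral measure. (2) Suppose that $\mu(K)=\inf\{\pi(f):K\prec f\}$ for every compact subset $K$ of $X$, and that $\mu$ is inner regular at all Borel subsets with finite measure. Then $\mu$ is a spectral measure.
   Context: All vector spaces are over $\mathbb R$. A partially ordered vector space has a proper (not necessarily generating) positive cone and is always supposed to be Archimedean. $x_\lambda\uparrow x$ means that $(x_\lambda)$ is an increasing net with supremum $x$. A partially ordered vector space is monotone complete if every increasing net that is bounded above has a supremum. A partially ordered algebra $A$ is an associative algebra that is also a partially ordered vector space, with positive cone $A^+$, such that $ab\in A^+$ for $a,b\in A^+$; no identity element is assumed. Its multiplication is monotone continuous if, for all nets in $A^+$ with $a_\lambda\uparrow a\in A^+$, one has $ba_\lambda\uparrow ba$ and $a_\lambda b\uparrow ab$ for all $b\in A^+$. $\overline A=A\cup\{\infty\}$ with $\infty$ adjoined as largest element, and $\overline{A^+}=A^+\cup\{\infty\}$ with the obvious addition. $\mathscr B$ is the Borel $\sigma$-algebra of $X$ (generated by the open subsets). A measure $\mu\colon\mathscr B\to\overline{A^+}$ is a map with $\mu(\emptyset)=0$ and $\mu(\bigcup_n\Delta_n)=\bigvee_{N}\sum_{n=1}^N\mu(\Delta_n)$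 in $\overline A$ for every pairwise disjoint sequence in $\mathscr B$. $\Delta$ has finite measure if $\mu(\Delta)\in A$. $\mu$ is a Borel measure if all compact sets have finite measure; inner regular at $\Delta$ if $\mu(\Delta)=\bigvee\{\mu(K):K\text{ compact},K\subseteq\Delta\}$ in $\overline A$; outer regular at $\Delta$ if $\mu(\Delta)=\bigwedge\{\mu(V):V\text{ open},\Delta\subseteq V\}$ in $\overline A$; a regular Borel measure is a Borel measure that is inner regular at all open sets and outer regular at all Borel sets. $\mu$ is a spectral measure if $\mu(\Delta_1\cap\Delta_2)=\mu(\Delta_1)\mu(\Delta_2)$ for all $\Delta_1,\Delta_2\in\mathscr B$ with finite measure. $C_c(X)$ is the algebra of real-valued compactly supported continuous functions. For $S\subseteq X$: $f\prec S$ means $f\in C_c(X)$, $0\le f\le1$, $\operatorname{supp}f\subseteq S$; $S\prec f$ means $f\in C_c(X)$, $0\le f\le1$, $f=1$ on $S$. *)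

(* Defs.v *)
From HB Require Import structures.
From mathcomp Require Import all_boot all_order all_algebra.
From mathcomp Require Import all_classical all_reals all_analysis.
Import Order.TTheory GRing.Theory Num.Theory.
Import numFieldNormedType.Exports.

Set Implicit Arguments.
Unset Strict Implicit.
Unset Printing Implicit Defensive.

Local Open Scope classical_set_scope.
Local Open Scope ring_scope.

(** The positive cone is [[set x | 0 <= x]]. It is proper because the order is
    antisymmetric, and it is not assumed to be generating. *)
HB.mixin Record POrderedZmodule_isPOVector (R : realType) V
    of Num.POrderedZmodule V & GRing.Lmodule R V := {
  pov_leD2r : forall z x y : V, x <= y -> x + z <= y + z;
  pov_scale_ge0 : forall (c : R) (x : V), 0 <= c -> 0 <= x -> 0 <= c *: x;
  pov_archimedean : forall x y : V, (forall n : nat, x *+ n <= y) -> x <= 0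
}.

#[short(type="poVectType")]
HB.structure Definition POVector (R : realType) :=
  { V of Num.POrderedZmodule V & GRing.Lmodule R V
       & POrderedZmodule_isPOVector R V }.

(** The algebra structures of the library are unital, so the product is a new
    operation here. *)
HB.mixin Record POVector_isPOAlgebra (R : realType) A of POVector R A := {
  pomul : A -> A -> A;
  pomulA : associative pomul;
  pomulDl : left_distributive pomul +%R;
  pomulDr : right_distributive pomul +%R;
  pomulZl : forall (c : R) (a b : A), pomul (c *: a) b = c *: pomul a b;
  pomulZr : forall (c : R) (a b : A), pomul a (c *: b) = c *: pomul a b;
  pomul_ge0 : forall a b : A, 0 <= a -> 0 <= b -> 0 <= pomul a b
}.

#[short(type="poAlgType")]
HB.structure Definition POAlgebra (R : realType) :=
  { A of POVector R A & POVector_isPOAlgebra R A }.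

Notation "a ** b" := (pomul a b) (at level 40, left associativity) : ring_scope.

Definition directed (I : Type) (r : I -> I -> Prop) : Prop :=
  [/\ inhabited I, forall i, r i i,
      forall i j k, r i j -> r j k -> r i k
    & forall i j, exists k, r i k /\ r j k].

Section Nets.
Variable A : porderZmodType.

Definition increasing_net (I : Type) (r : I -> I -> Prop) (x : I -> A) : Prop :=
  directed r /\ forall i j, r i j -> x i <= x j.

Definition net_up (I : Type) (r : I -> I -> Prop) (x : I -> A) (a : A) : Prop :=
  increasing_net r x /\ supremums (range x) a.

Definition monotone_complete : Prop :=
  forall (I : Type) (r : I -> I -> Prop) (x : I -> A),
    increasing_net r x -> has_ubound (range x) ->
    exists a, supremums (range x) a.

End Nets.

Definition monotone_continuous_mul (R : realType) (A : poAlgType R) : Prop :=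
  forall (I : Type) (r : I -> I -> Prop) (x : I -> A) (a : A),
    (forall i, 0 <= x i) -> 0 <= a -> net_up r x a ->
    forall b : A, 0 <= b ->
      net_up r (fun i => b ** x i) (b ** a) /\
      net_up r (fun i => x i ** b) (a ** b).

(** [adjoin_infty A] is A with a largest element [Infty] adjoined; the addition
    is absorbing at [Infty]. *)
Definition adjoin_infty (A : Type) : Type := option A.
Definition Fin (A : Type) (a : A) : adjoin_infty A := Some a.
Definition Infty (A : Type) : adjoin_infty A := None.
Arguments Infty {A}.

Section AdjoinInfty.
Variable A : porderZmodType.

Definition ext_le (x y : adjoin_infty A) : bool :=
  match x, y with
  | _, None => true
  | None, Some _ => false
  | Some a, Some b => a <= b
  end.

Definition ext_add (x y : adjoin_infty A) : adjoin_infty A :=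
  match x, y with
  | Some a, Some b => Fin (a + b)
  | _, _ => Infty
  end.

Lemma ext_le_refl : reflexive ext_le.
Proof. by case=> [a|] /=. Qed.

Lemma ext_le_anti : antisymmetric ext_le.
Proof. by case=> [a|] [b|] //= /le_anti ->. Qed.

Lemma ext_le_trans : transitive ext_le.
Proof. by case=> [b|] [a|] [c|] //=; apply: le_trans. Qed.

Lemma ext_addA : associative ext_add.
Proof. by case=> [a|] [b|] [c|] //=; rewrite addrA. Qed.

Lemma ext_addC : commutative ext_add.
Proof. by case=> [a|] [b|] //=; rewrite addrC. Qed.

Lemma ext_add0 : left_id (Fin (0 : A)) ext_add.
Proof. by case=> [a|] //=; rewrite add0r. Qed.

HB.instance Definition _ := Choice.copy (adjoin_infty A) (option A).
HB.instance Definition _ := Order.Le_isPOrder.Build ring_display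
  (adjoin_infty A) ext_le_refl ext_le_anti ext_le_trans.
HB.instance Definition _ := GRing.isNmodule.Build
  (adjoin_infty A) ext_addA ext_addC ext_add0.

End AdjoinInfty.

Definition borel (X : topologicalType) : set (set X) := <<s open >>.

(** A set function is total on [set X], but only its values on Borel sets are
    constrained or used. *)
Section Measures.
Variables (X : topologicalType) (A : porderZmodType).
Variable mu : set X -> adjoin_infty A.

Definition finite_measure_at (D : set X) : Prop := exists a, mu D = Fin a.

Record is_measure : Prop := {
  measure_pos : forall D, borel D -> Fin 0 <= mu D;
  measure_empty : mu set0 = Fin 0;
  measure_sigma_additive : forall D : nat -> set X,
    (forall n, borel (D n)) -> trivIset setT D ->
    supremums (range (fun N : nat => \sum_(n < N.+1) mu (D n)))
              (mu (\bigcup_n D n))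
}.

Definition inner_regular_at (D : set X) : Prop :=
  supremums [set mu K | K in [set K | compact K /\ K `<=` D]] (mu D).

Definition outer_regular_at (D : set X) : Prop :=
  infimums [set mu V | V in [set V | open V /\ D `<=` V]] (mu D).

Record regular_borel_measure : Prop := {
  rbm_measure : is_measure;
  rbm_compact_finite : forall K, compact K -> finite_measure_at K;
  rbm_inner_open : forall V, open V -> inner_regular_at V;
  rbm_outer_borel : forall D, borel D -> outer_regular_at D
}.

End Measures.

Definition spectral_measure (R : realType) (X : topologicalType)
    (A : poAlgType R) (mu : set X -> adjoin_infty A) : Prop :=
  forall (D1 D2 : set X) (a1 a2 : A), borel D1 -> borel D2 ->
    mu D1 = Fin a1 -> mu D2 = Fin a2 -> mu (D1 `&` D2) = Fin (a1 ** a2).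

Section CompactlySupported.
Variables (R : realType) (X : topologicalType).

Definition supp (f : X -> R) : set X := closure [set x | f x != 0].

Definition Cc : set (X -> R) := [set f | continuous f /\ compact (supp f)].

(** f ≺ S *)
Definition prec_set (f : X -> R) (S : set X) : Prop :=
  [/\ Cc f, forall x, 0 <= f x <= 1 & supp f `<=` S].

(** S ≺ f *)
Definition set_prec (S : set X) (f : X -> R) : Prop :=
  [/\ Cc f, forall x, 0 <= f x <= 1 & forall x, S x -> f x = 1].

End CompactlySupported.

(** A map on [Cc X] is represented by a map on all functions [X -> R], whose
    values outside [Cc X] are neither constrained nor used. *)
Record positive_alg_hom (R : realType) (X : topologicalType) (A : poAlgType R)
    (pi : (X -> R) -> A) : Prop := {
  pahD : forall f g, Cc f -> Cc g -> pi (fun x => f x + g x) = pi f + pi g;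
  pahZ : forall (c : R) f, Cc f -> pi (fun x => c * f x) = c *: pi f;
  pahM : forall f g, Cc f -> Cc g -> pi (fun x => f x * g x) = pi f ** pi g;
  pah_ge0 : forall f, Cc f -> (forall x, 0 <= f x) -> 0 <= pi f
}.

(* Main.v *)
Require Import Defs.
From mathcomp Require Import all_boot all_order all_algebra.
From mathcomp Require Import all_classical all_reals all_analysis.
From mathcomp Require Import lra.
Import Order.TTheory GRing.Theory Num.Theory.
Import numFieldNormedType.Exports.
Local Open Scope classical_set_scope.
Local Open Scope ring_scope.

(** For open [V1], [V2] of finite measure, [f ≺ V1] and [g ≺ V2] give
    [pi f ** pi g = pi (f g) <= mu (V1 ∩ V2)], hence
    [mu V1 ** mu V2 <= mu (V1 ∩ V2)] by monotone continuity; conversely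
    [h ≺ V1 ∩ V2] factors as [sqrt h * sqrt h] with [sqrt h ≺ V1] and
    [sqrt h ≺ V2]. Outer regularity and
    [mu (V1 ∩ V2) <= mu (D1 ∩ D2) + mu (V1 \ D1) + mu (V2 \ D2)] carry the
    multiplicativity over to Borel sets. The second part reduces to the first:
    [pi f <= mu (supp f) <= mu V] for [f ≺ V], and Urysohn's lemma yields
    [mu K <= pi f] for some [f ≺ V] whenever [K] is a compact subset of [V]. *)

(** * Order arithmetic and directed sets in a partially ordered vector space *)

Section OrderedVectorSpaces.
Context {R : realType} {A : poVectType R}.
Implicit Types x y z : A.

Lemma pov_leD2rE z x y : (x + z <= y + z) = (x <= y).
Proof.
apply/idP/idP; last exact: pov_leD2r.
by move=> /(pov_leD2r (- z)); rewrite !addrK.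
Qed.

Lemma pov_leD2lE z x y : (z + x <= z + y) = (x <= y).
Proof. by rewrite ![z + _]addrC pov_leD2rE. Qed.

Lemma pov_subr_ge0 x y : (0 <= y - x) = (x <= y).
Proof. by rewrite -(pov_leD2rE x 0) add0r subrK. Qed.

Lemma pov_lerBlDr x y z : (x - y <= z) = (x <= z + y).
Proof. by rewrite -(pov_leD2rE y (x - y)) subrK. Qed.

Lemma pov_lerBrDr x y z : (x <= y - z) = (x + z <= y).
Proof. by rewrite -(pov_leD2rE z x) subrK. Qed.

Lemma pov_leB2lE z x y : (z - x <= z - y) = (y <= x).
Proof. by rewrite pov_lerBlDr addrAC pov_lerBrDr pov_leD2lE. Qed.

(** Directed sets stand in for monotone nets: such a set is a net indexed by its own elements. *)
Definition up_directed (S : set A) :=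
  S !=set0 /\ forall x y, S x -> S y -> exists z, [/\ S z, x <= z & y <= z].

Definition down_directed (S : set A) :=
  S !=set0 /\ forall x y, S x -> S y -> exists z, [/\ S z, z <= x & z <= y].

End OrderedVectorSpaces.

(** * Monotone continuity of the product along directed sets *)

Section MonotoneContinuity.
Context {R : realType} {A : poAlgType R}.
Hypothesis A_mul_continuous : monotone_continuous_mul A.
Implicit Types (S : set A) (a b c : A) (T : A -> A).

Lemma pomulN a b : a ** (- b) = - (a ** b).
Proof. by rewrite -scaleN1r pomulZr scaleN1r. Qed.

Lemma pomulNl a b : (- a) ** b = - (a ** b).
Proof. by rewrite -scaleN1r pomulZl scaleN1r. Qed.

Lemma pomulBr a b c : a ** (b - c) = a ** b - a ** c.
Proof. by rewrite pomulDr pomulN. Qed.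

Lemma pomulBl a b c : (a - b) ** c = a ** c - b ** c.
Proof. by rewrite pomulDl pomulNl. Qed.

Lemma ler_pomul a b c d : 0 <= a -> 0 <= d -> a <= b -> c <= d ->
  a ** c <= b ** d.
Proof.
move=> a0 d0 ab cd; apply: (@le_trans _ _ (a ** d)).
  by rewrite -pov_subr_ge0 -pomulBr pomul_ge0 // pov_subr_ge0.
by rewrite -pov_subr_ge0 -pomulBl pomul_ge0 // pov_subr_ge0.
Qed.

(** Only the inequality that monotonicity does not give is recorded. Testing against upper bounds
    [c] avoids speaking of a supremum of the image. *)
Definition sup_continuous T := forall S a, up_directed S ->
  (forall x, S x -> 0 <= x) -> supremums S a ->
  forall c, (forall x, S x -> T x <= c) -> T a <= c.

Definition inf_continuous T := forall S a, down_directed S ->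
  (forall x, S x -> 0 <= x) -> infimums S a ->
  forall c, (forall x, S x -> c <= T x) -> c <= T a.

(** The hypothesis on nets is applied to [S] indexed by itself, with the order inherited from
    [A]. *)
Lemma pomul_sup_continuous b : 0 <= b ->
  sup_continuous (pomul b) /\ sup_continuous (pomul^~ b).
Proof.
move=> b0.
have main S a : up_directed S -> (forall x, S x -> 0 <= x) -> supremums S a ->
  let r := fun u v : {x | S x} => sval u <= sval v in
  net_up r (fun u => b ** sval u) (b ** a) /\
  net_up r (fun u => sval u ** b) (a ** b).
  move=> [[x0 Sx0] dS] S0 [ubS lbS].
  apply: A_mul_continuous => //.
  - by case=> x Sx /=; exact: S0.
  - exact: le_trans (S0 _ Sx0) (ubS _ Sx0).
  - split.
      split=> //; split.
      + by constructor; exists x0.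
      + by [].
      + by move=> i j k; exact: le_trans.
      + move=> [x Sx] [y Sy]; have [z [Sz xz yz]] := dS _ _ Sx Sy.
        by exists (exist _ z Sz).
    split.
      by move=> _ [[x Sx] _ <-]; exact: ubS.
    move=> c cub; apply: lbS => x Sx; apply: cub.
    by exists (exist _ x Sx).
split=> S a dS S0 aS c Sc; have [[_ [_ lb1]] [_ [_ lb2]]] := main S a dS S0 aS.
  by apply: lb1 => _ [[x Sx] _ <-]; exact: Sc.
by apply: lb2 => _ [[x Sx] _ <-]; exact: Sc.
Qed.

(* For a fixed [x0] in the set, [x0 - x] increases to [x0 - a] as [x]
   decreases to [a]. *)
Lemma sup_inf_continuous T : {morph T : x y / x - y} ->
  sup_continuous T -> inf_continuous T.
Proof.
move=> TB Tsup S a [[x0 Sx0] dS] S0 [lba uba] c cT.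
rewrite -(pov_leB2lE (T x0)) -TB.
(* The restriction to [x <= x0] keeps the differences in the positive cone, as [sup_continuous]
   requires. *)
apply: (Tsup [set x0 - x | x in [set x | S x /\ x <= x0]]).
- split; first by exists (x0 - x0); exists x0.
  move=> _ _ [x [Sx xx0] <-] [y [Sy yx0] <-].
  have [z [Sz zx zy]] := dS _ _ Sx Sy; exists (x0 - z).
  rewrite !pov_leB2lE; split=> //; exists z => //; split=> //.
  exact: le_trans zx xx0.
- by move=> _ [x [_ xx0] <-]; rewrite pov_subr_ge0.
- split.
    by move=> _ [x [Sx _] <-]; rewrite pov_leB2lE lba.
  move=> d dub; rewrite pov_lerBlDr addrC -pov_lerBlDr.
  (* An arbitrary [x] need not lie below [x0]; directedness gives a [z] below both, to which the
     bound [d] applies. *)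
  apply: uba => x Sx; have [z [Sz zx zx0]] := dS _ _ Sx Sx0.
  apply: le_trans zx; rewrite pov_lerBlDr addrC -pov_lerBlDr.
  by apply: dub; exists z.
- by move=> _ [x [Sx _] <-]; rewrite TB pov_leB2lE; exact: cT.
Qed.

(** Two limits in one variable, taken in succession: the first factor rises to [a1] for each fixed
    [y], then the second rises to [a2] with [a1] fixed. *)
Lemma supremums_pomul_le S1 S2 a1 a2 c :
  up_directed S1 -> up_directed S2 ->
  (forall x, S1 x -> 0 <= x) -> (forall x, S2 x -> 0 <= x) ->
  supremums S1 a1 -> supremums S2 a2 ->
  (forall x y, S1 x -> S2 y -> x ** y <= c) -> a1 ** a2 <= c.
Proof.
move=> d1 d2 p1 p2 s1 s2 H.
have a1_ge0 : 0 <= a1.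
  by have [[x Sx] _] := d1; exact: le_trans (p1 _ Sx) (s1.1 _ Sx).
apply: (pomul_sup_continuous a1 a1_ge0).1 s2 _ _ => // y S2y.
by apply: (pomul_sup_continuous y (p2 _ S2y)).2 s1 _ _ => // x S1x; exact: H.
Qed.

Lemma infimums_pomul_ge S1 S2 a1 a2 c :
  down_directed S1 -> down_directed S2 ->
  (forall x, S1 x -> 0 <= x) -> (forall x, S2 x -> 0 <= x) ->
  infimums S1 a1 -> infimums S2 a2 ->
  (forall x y, S1 x -> S2 y -> c <= x ** y) -> c <= a1 ** a2.
Proof.
move=> d1 d2 p1 p2 s1 s2 H.
have a1_ge0 : 0 <= a1 by apply: s1.2 => x /p1.
apply: (sup_inf_continuous _ (pomulBr a1)
  (pomul_sup_continuous a1 a1_ge0).1) s2 _ _ => // y S2y.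
apply: (sup_inf_continuous _ (fun x z => pomulBl x z y)
  (pomul_sup_continuous y (p2 _ S2y)).2) s1 _ _ => // x S1x; exact: H.
Qed.

End MonotoneContinuity.

(** * Closure properties of the Borel sets *)

Section BorelSets.
Context {X : topologicalType}.
Implicit Types D E : set X.

Lemma borel_open D : open D -> borel D.
Proof. by move=> oD; exact: sub_sigma_algebra. Qed.

Lemma borel0 : borel (@set0 X).
Proof. exact: sigma_algebra0. Qed.

Lemma borelC D : borel D -> borel (~` D).
Proof. by rewrite -setTD; exact: sigma_algebraCD. Qed.

Lemma borelU D E : borel D -> borel E -> borel (D `|` E).
Proof.
move=> bD bE; rewrite -bigcup2E; apply: sigma_algebra_bigcup.
by case=> [|[|n]] //=; exact: borel0.
Qed.

Lemma borelI D E : borel D -> borel E -> borel (D `&` E).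
Proof.
move=> bD bE; rewrite -(setCK (D `&` E)) setCI.
by apply: borelC; apply: borelU; apply: borelC.
Qed.

Lemma borelD D E : borel D -> borel E -> borel (D `\` E).
Proof. by move=> bD bE; rewrite setDE; apply: borelI => //; apply: borelC. Qed.

Lemma borel_closed D : closed D -> borel D.
Proof.
move=> cD; rewrite -(setCK D); apply: borelC; apply: borel_open.
exact: closed_openC.
Qed.

End BorelSets.

(** * Finite additivity, monotonicity and outer approximation for measures with values in the
    extended cone *)

Section MeasureTheory.
Context {R : realType} {X : topologicalType} {A : poVectType R}.
Context {mu : set X -> adjoin_infty A}.
Hypothesis mu_measure : is_measure mu.
Implicit Types D E V : set X.

Lemma ext_leDl (x y : adjoin_infty A) : Fin 0 <= y -> x <= x + y.
Proof.
case: x y => [x|] [y|] //= y0; rewrite /Order.le /=.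
by rewrite -{1}[x]addr0 pov_leD2lE.
Qed.

Lemma ext_leD2l (z x y : adjoin_infty A) : x <= y -> z + x <= z + y.
Proof. by case: x y z => [x|] [y|] [z|] //=; rewrite /Order.le /= pov_leD2lE. Qed.

(** Countable additivity is applied to the sequence [D], [E], followed by empty sets. *)
Lemma measure_setU D E : borel D -> borel E -> D `&` E = set0 ->
  mu (D `|` E) = mu D + mu E.
Proof.
move=> bD bE DE0.
have bDE n : borel (bigcup2 D E n).
  by case: n => [|[|n]] //=; exact: borel0.
have := Defs.measure_sigma_additive mu_measure bDE.
rewrite -trivIset_bigcup2 => /(_ DE0); rewrite bigcup2E => -[ub lub].
apply/le_anti/andP; split.
  (* The partial sum with index [N] has [N.+1] terms: index 0 gives [mu D], and every later one
     gives [mu D + mu E]. *)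
  apply: lub => _ [[|n] _ <-].
    rewrite big_ord_recl big_ord0 addr0 /=.
    exact: ext_leDl (measure_pos mu_measure _).
  rewrite 2!big_ord_recl /= big1 ?addr0 // => i _.
  exact: measure_empty.
by apply: ub; exists 1%N => //; rewrite 2!big_ord_recl big_ord0 addr0.
Qed.

Lemma measure_setD D E : borel D -> borel E -> D `<=` E ->
  mu E = mu D + mu (E `\` D).
Proof.
move=> bD bE DE; rewrite -measure_setU ?setDUK //; first exact: borelD.
by rewrite setDIK.
Qed.

Lemma measure_mono D E : borel D -> borel E -> D `<=` E -> mu D <= mu E.
Proof.
move=> bD bE DE; rewrite (measure_setD D E) //.
by apply: ext_leDl; apply: (measure_pos mu_measure); exact: borelD.
Qed.

Lemma measure_subadditive D E : borel D -> borel E ->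
  mu (D `|` E) <= mu D + mu E.
Proof.
move=> bD bE; have bED := borelD _ _ bE bD.
have -> : D `|` E = D `|` (E `\` D) by rewrite setDE setUIr setUv setIT.
rewrite measure_setU ?setDIK //.
by apply: ext_leD2l; exact: measure_mono.
Qed.

Lemma measure_le_fin D E a : borel D -> borel E -> D `<=` E -> mu E = Fin a ->
  exists2 b, mu D = Fin b & b <= a.
Proof.
move=> bD bE DE Ea; have := measure_mono D E bD bE DE; rewrite Ea.
by case: (mu D) => // b ba; exists b.
Qed.

(** The difference cannot have measure [Infty], which would absorb the sum [mu E]; the rest is
    cancellation in [A]. *)
Lemma measure_setD_fin D E a b : borel D -> borel E -> D `<=` E ->
  mu D = Fin a -> mu E = Fin b -> mu (E `\` D) = Fin (b - a).
Proof.
move=> bD bE DE Da Eb; have := measure_setD D E bD bE DE; rewrite Da Eb.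
by case: (mu _) => [c|] // [->]; rewrite addrC addrA addNr add0r.
Qed.

Lemma measure_fin_ge0 D a : borel D -> mu D = Fin a -> 0 <= a.
Proof. by move=> bD Da; have := measure_pos mu_measure bD; rewrite Da. Qed.

(** Restricting to finite values places the set in [A], where the product is defined. *)
Definition open_measures D : set A :=
  [set v | exists V, [/\ open V, D `<=` V & mu V = Fin v]].

Lemma open_measures_directed D a : borel D -> outer_regular_at mu D ->
  mu D = Fin a -> down_directed (open_measures D).
Proof.
move=> bD oD Da; split.
  (* If every open superset had infinite measure, [Infty] would be a lower bound of their measures,
     hence at most [mu D], which is finite. *)
  apply: contrapT => noV; have [_ glb] := oD.
  suff : (Infty : adjoin_infty A) <= mu D by rewrite Da.
  apply: glb => _ [V [oV DV] <-]; case VE : (mu V) => [v|] //.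
  by exfalso; apply: noV; exists v, V.
move=> x y [V [oV DV Vx]] [W [oW DW Wy]].
have oVW : open (V `&` W) by exact: openI.
have bV := borel_open _ oV; have bW := borel_open _ oW.
have bVW := borel_open _ oVW.
have [z zE zx] := measure_le_fin _ _ _ bVW bV (@subIsetl _ _ _) Vx.
exists z; split=> //.
  by exists (V `&` W); split=> // t Dt; split; [exact: DV|exact: DW].
by have := measure_mono _ _ bVW bW (@subIsetr _ _ _); rewrite zE Wy.
Qed.

(** Discarding the value [Infty] changes no lower bound in [A], so outer regularity gives an infimum
    in [A] itself. *)
Lemma open_measures_infimum D a : outer_regular_at mu D ->
  mu D = Fin a -> infimums (open_measures D) a.
Proof.
move=> [lb glb] Da; split.
  move=> v [V [oV DV Vv]].
  by have := lb _ (ex_intro2 _ _ V (conj oV DV) erefl); rewrite Da Vv.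
move=> c cl; have := glb (Fin c); rewrite Da; apply.
move=> _ [V [oV DV] <-]; case VE : (mu V) => [v|] //.
by apply: (cl v); exists V.
Qed.

Lemma open_measures_ge0 D v : open_measures D v -> 0 <= v.
Proof. by move=> [V [/borel_open bV _ /(measure_fin_ge0 _ _ bV)]]. Qed.

End MeasureTheory.

(** * Compactly supported functions and Urysohn's lemma *)

Section CcFunctions.
Context {R : realType} {X : topologicalType}.
Implicit Types (f g : X -> R) (K V : set X).

Lemma supp_sub f K : closed K -> (forall x, f x != 0 -> K x) -> supp f `<=` K.
Proof. by move=> /closure_id {2}-> fK; exact: closureS. Qed.

Lemma Cc_sub f K : continuous f -> compact K -> supp f `<=` K -> Cc f.
Proof.
move=> cf cK fK; split=> //.
by apply: subclosed_compact cK fK; exact: closed_closure.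
Qed.

Lemma suppMl f g : supp (fun x => f x * g x) `<=` supp f.
Proof.
apply: closureS => x /=; apply: contraNN => /eqP ->.
by rewrite mul0r.
Qed.

Lemma suppMr f g : supp (fun x => f x * g x) `<=` supp g.
Proof.
apply: closureS => x /=; apply: contraNN => /eqP ->.
by rewrite mulr0.
Qed.

Lemma suppD f g : supp (fun x => f x + g x) `<=` supp f `|` supp g.
Proof.
rewrite /supp -closureU; apply: closureS => x /=.
have [->|fx _] := eqVneq (f x) 0; last by left.
by rewrite add0r => gx; right.
Qed.

Lemma CcM f g : Cc f -> Cc g -> Cc (fun x => f x * g x).
Proof.
move=> [cf sf] [cg sg]; apply: Cc_sub sf _; last exact: suppMl.
by move=> x; apply: continuousM; [exact: cf|exact: cg].
Qed.

Lemma CcD f g : Cc f -> Cc g -> Cc (fun x => f x + g x).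
Proof.
move=> [cf sf] [cg sg].
apply: Cc_sub (compactU sf sg) _; last exact: suppD.
by move=> x; apply: continuousD; [exact: cf|exact: cg].
Qed.

Lemma CcZ (c : R) f : Cc f -> Cc (fun x => c * f x).
Proof.
move=> [cf sf]; apply: Cc_sub sf _; last exact: suppMr.
by move=> x; apply: continuousM; [exact: cst_continuous|exact: cf].
Qed.

Lemma prec_setM f g V W : prec_set f V -> prec_set g W ->
  prec_set (fun x => f x * g x) (V `&` W).
Proof.
move=> [cf f01 fV] [cg g01 gW]; split; first exact: CcM.
  move=> x; have /andP[f0 f1] := f01 x; have /andP[g0 g1] := g01 x.
  by rewrite mulr_ge0 //= mulr_ile1.
by move=> x fgx; split; [exact/fV/(suppMl f g)|exact/gW/(suppMr f g)].
Qed.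

(** The function is [1 - (1 - f)(1 - g)], which takes values in [0, 1] and dominates both [f] and
    [g]; it makes the values of [pi] directed. *)
Lemma prec_set_join f g V : prec_set f V -> prec_set g V ->
  prec_set (fun x => (f x + g x) + -1 * (f x * g x)) V.
Proof.
move=> pf pg; have [cf f01 fV] := pf; have [cg g01 gV] := pg.
have [cfg _ fgV] := prec_setM _ _ _ _ pf pg; split.
- exact/CcD/CcZ/CcM/cg/cf/CcD.
- move=> x; have /andP[f0 f1] := f01 x; have /andP[g0 g1] := g01 x.
  by apply/andP; split; nra.
- move=> x /suppD[/suppD[/fV|/gV]|/suppMr/fgV[]] //.
Qed.

Lemma prec_set_sqrt f V : prec_set f V -> prec_set (fun x => Num.sqrt (f x)) V.
Proof.
move=> [[cf sf] f01 fV].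
have sE : supp (fun x => Num.sqrt (f x)) `<=` supp f.
  by apply: closureS => x /=; apply: contraNN => /eqP ->; rewrite sqrtr0.
split.
- apply: Cc_sub sf sE => x.
  by apply: (@continuous_comp _ _ _ f Num.sqrt); [exact: cf|exact: sqrt_continuous].
- move=> x; have /andP[_ f1] := f01 x.
  by rewrite sqrtr_ge0 /= -sqrtr1 ler_wsqrtr.
- exact: subset_trans fV.
Qed.

Lemma prec_set0 V : prec_set (fun=> 0 : R) V.
Proof.
have s0 : supp (fun=> 0 : R) `<=` (@set0 X).
  by apply: supp_sub => [|x]; [exact: closed0|rewrite eqxx].
split.
- by apply: Cc_sub (@compact0 _) s0; exact: cst_continuous.
- by move=> x; rewrite lexx ler01.
- exact: subset_trans s0 _.
Qed.

(** The one-point compactification is compact Hausdorff, hence normal. There the image of [K] is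
    separated from the complement of the image of [V], which contains the point at infinity. *)
Lemma locally_compact_urysohn K V :
  hausdorff_space X -> locally_compact [set: X] ->
  compact K -> open V -> K `<=` V ->
  exists f, prec_set f V /\ set_prec K f.
Proof.
move=> hX lX cK oV KV.
pose Y := one_point_compactification X.
have hY : hausdorff_space Y by exact: one_point_compactification_hausdorff.
have nY : normal_space Y.
  exact: compact_normal hY one_point_compactification_compact.
have clK : closed (Some @` K : set Y).
  apply: compact_closed => //; apply: continuous_compact => //.
  apply: continuous_subspaceT.
  exact: one_point_compactification_some_continuous.
have clV : closed (~` (Some @` V) : set Y).
  exact/open_closedC/one_point_compactification_open_some.
have disj : ~` (Some @` V) `&` (Some @` K) = set0 :> set Y.
  apply/disjoints_subset; apply: subsetC; exact: image_subset.
have /(@uniform_separatorP _ R)[f [cf f01 f0 f1]] :=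
  (@normal_separatorP R Y).1 nY _ _ clV clK disj.
have {}f01 y : 0 <= f y <= 1.
  by have := f01 (f y) (ex_intro2 _ _ y I erefl); rewrite /= in_itv.
have fN : f None = 0 by apply: f0; exists None => //; case=> ? _.
have nf : nbhs (f None) [set z : R | z < 1 / 2].
  by apply: open_nbhs_nbhs; split; [exact: open_lt|rewrite /= fN; lra].
(* Since [f] vanishes at infinity, it stays below 1/2 outside some closed compact set [W]; this will
   give compact support. *)
have [W [cW clW] WE] := cf None _ nf.
have cfS : continuous (fun x => f (Some x)).
  move=> x; apply: (@continuous_comp _ Y _ Some f).
    exact: one_point_compactification_some_continuous.
  exact: cf.
pose C := [set x | 1 / 2 <= f (Some x)].
have clC : closed C.
  exact: (@closed_comp _ _ (fun x => f (Some x)) _ (fun x _ => cfS x)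
    (@closed_ge R (1 / 2))).
(* Truncating [f] at [1 / 2] puts the whole support inside [V]. *)
pose g x := Num.max 0 (2 * f (Some x) - 1).
have gC : supp g `<=` C.
  apply: supp_sub => // x; apply: contraNP => /negP; rewrite -ltNge => fx.
  by apply/eqP/max_idPl; lra.
have CW : C `<=` W.
  move=> x; rewrite /C /= leNgt => /negP; apply: contra_notP => Wx.
  by apply: WE; left; exists x.
have cg : Cc g.
  apply: Cc_sub cW (subset_trans gC CW) => x.
  apply: (@continuous_max R X (fun=> 0) (fun x => 2 * f (Some x) - 1)).
    exact: cst_continuous.
  apply: continuousB; last exact: cst_continuous.
  by apply: continuousM; [exact: cst_continuous|exact: cfS].
have g01 x : 0 <= g x <= 1.
  have /andP[fx0 fx1] := f01 (Some x).
  by rewrite le_max lexx /= ge_max ler01 /=; lra.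
exists g; split; split=> //.
  apply: subset_trans gC _ => x; rewrite /C /= => fx.
  (* Off [V] the function [f] is 0, whereas it is at least 1/2 on [C]. *)
  apply: contrapT => nVx; have : f (Some x) = 0; last by lra.
  by apply: f0; exists (Some x) => // -[y Vy [yx]]; apply: nVx; rewrite -yx.
move=> x Kx; rewrite /g (f1 (f (Some x))); last by exists (Some x) => //; exists x.
rewrite (_ : 2 * 1 - 1 = 1); last by lra.
exact: (max_idPr (@ler01 R)).
Qed.

End CcFunctions.

(** * Multiplicativity of the measure, first on open sets and then on Borel sets *)

Section PositiveHomomorphisms.
Context {R : realType} {X : topologicalType} {A : poAlgType R}.
Context {mu : set X -> adjoin_infty A}.
Context { pi : (X -> R) -> A}.
Hypothesis pi_hom : positive_alg_hom pi.

Lemma pi_mono f g : Cc f -> Cc g -> (forall x, f x <= g x) -> pi f <= pi g.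
Proof.
move=> cf cg fg; have cNf := CcZ (-1) f cf.
rewrite -pov_subr_ge0 -scaleN1r -(pahZ pi_hom) // -(pahD pi_hom) //.
apply: (pah_ge0 pi_hom); first exact: CcD.
by move=> x; rewrite mulN1r subr_ge0.
Qed.

Definition prec_values (V : set X) : set A :=
  [set pi f | f in [set f | prec_set f V]].

Lemma prec_values_ge0 V a : prec_values V a -> 0 <= a.
Proof.
move=> [f [cf f01 _] <-]; apply: (pah_ge0 pi_hom) => // x.
by have /andP[] := f01 x.
Qed.

Lemma prec_values_directed V : up_directed (prec_values V).
Proof.
split; first by exists (pi (fun=> 0)); exists (fun=> 0) => //; exact: prec_set0.
move=> _ _ [f pf <-] [g pg <-]; have ph := prec_set_join _ _ _ pf pg.
have [cf f01 _] := pf; have [cg g01 _] := pg; have [ch _ _] := ph.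
exists (pi (fun x => (f x + g x) + -1 * (f x * g x))); split.
- by exists (fun x => (f x + g x) + -1 * (f x * g x)).
(* The join exceeds [f] by [g (1 - f)], which is nonnegative; the case of [g] is symmetric. *)
- apply: pi_mono => // x.
  have /andP[f0 f1] := f01 x; have /andP[g0 g1] := g01 x; nra.
- apply: pi_mono => // x.
  have /andP[f0 f1] := f01 x; have /andP[g0 g1] := g01 x; nra.
Qed.

Hypothesis A_mul_continuous : monotone_continuous_mul A.
Hypothesis mu_regular : regular_borel_measure mu.
Hypothesis mu_open : forall (V : set X) (a : A), open V -> mu V = Fin a ->
  supremums (prec_values V) a.

Lemma measure_openI V1 V2 a1 a2 : open V1 -> open V2 ->
  mu V1 = Fin a1 -> mu V2 = Fin a2 -> mu (V1 `&` V2) = Fin (a1 ** a2).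
Proof.
move=> oV1 oV2 V1a V2a; have mm := rbm_measure mu_regular.
have oV := openI oV1 oV2.
(* The intersection inherits finite measure, so [mu_open] applies to it as well. *)
have [a Va _] := measure_le_fin mm _ _ _ (borel_open _ oV) (borel_open _ oV1)
  (@subIsetl _ _ _) V1a.
have [ub1 lub1] := mu_open _ _ oV1 V1a; have [ub2 lub2] := mu_open _ _ oV2 V2a.
have [ub lub] := mu_open _ _ oV Va.
rewrite Va; congr Fin; apply/le_anti/andP; split.
  apply: lub => _ [h ph <-].
  have [[ch h01 hV] ps] := (ph, prec_set_sqrt _ _ ph).
  have [cs s01 sV] := ps.
  have -> : h = (fun x => Num.sqrt (h x) * Num.sqrt (h x)).
    by apply/funext => x; rewrite -expr2 sqr_sqrtr //; have /andP[] := h01 x.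
  rewrite (pahM pi_hom) //.
  have s0 : 0 <= pi (fun x => Num.sqrt (h x)).
    by apply: (pah_ge0 pi_hom) => // x; exact: sqrtr_ge0.
  apply: ler_pomul => //.
  - exact: measure_fin_ge0 mm _ _ (borel_open _ oV2) V2a.
  - apply: ub1; exists (fun x => Num.sqrt (h x)) => //.
    by split=> //; apply: subset_trans sV _; exact: subIsetl.
  - apply: ub2; exists (fun x => Num.sqrt (h x)) => //.
    by split=> //; apply: subset_trans sV _; exact: subIsetr.
apply: (supremums_pomul_le A_mul_continuous (prec_values V1) (prec_values V2));
  try exact: prec_values_directed; try exact: prec_values_ge0; try exact: mu_open.
move=> _ _ [f pf <-] [g pg <-].
have [cf _ _] := pf; have [cg _ _] := pg.
rewrite -(pahM pi_hom) //; apply: ub; exists (fun x => f x * g x) => //.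
exact: prec_setM.
Qed.

Lemma spectral_of_open : spectral_measure mu.
Proof.
move=> D1 D2 a1 a2 bD1 bD2 D1a D2a; have mm := rbm_measure mu_regular.
have oD1 := rbm_outer_borel mu_regular bD1.
have oD2 := rbm_outer_borel mu_regular bD2.
have bD := borelI _ _ bD1 bD2.
have [d Dd _] := measure_le_fin mm _ _ _ bD bD1 (@subIsetl _ _ _) D1a.
have glb1 := open_measures_infimum _ _ oD1 D1a.
have glb2 := open_measures_infimum _ _ oD2 D2a.
rewrite Dd; congr Fin; apply/le_anti/andP; split.
  (* It suffices to bound [d] by [v1 ** v2], the measure of [V1 ∩ V2], for all open supersets of
     finite measure. *)
  apply: (infimums_pomul_ge A_mul_continuous _ _ _ _ _
    (open_measures_directed mm _ _ bD1 oD1 D1a)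
    (open_measures_directed mm _ _ bD2 oD2 D2a) _ _ glb1 glb2);
    try exact: open_measures_ge0.
  move=> v1 v2 [V1 [oV1 DV1 V1E]] [V2 [oV2 DV2 V2E]].
  have VE := measure_openI _ _ _ _ oV1 oV2 V1E V2E.
  have := measure_mono mm _ _ bD (borel_open _ (openI oV1 oV2)) (setISS DV1 DV2).
  by rewrite Dd VE.
(* The excess terms [v1 - a1] and [v2 - a2] are the measures of [V1 \ D1] and [V2 \ D2]. *)
have key v1 v2 : open_measures (mu := mu) D1 v1 -> open_measures (mu := mu) D2 v2 ->
    a1 ** a2 <= (v1 - a1) + ((v2 - a2) + d).
  move=> [V1 [oV1 DV1 V1E]] [V2 [oV2 DV2 V2E]].
  have VE := measure_openI _ _ _ _ oV1 oV2 V1E V2E.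
  have bV1 := borel_open _ oV1; have bV2 := borel_open _ oV2.
  have bV := borelI _ _ bV1 bV2; have DV := setISS DV1 DV2.
  have E1 := measure_setD_fin mm _ _ _ _ bD1 bV1 DV1 D1a V1E.
  have E2 := measure_setD_fin mm _ _ _ _ bD2 bV2 DV2 D2a V2E.
  have E := measure_setD_fin mm _ _ _ _ bD bV DV Dd VE.
  have b1 := borelD _ _ bV1 bD1; have b2 := borelD _ _ bV2 bD2.
  apply: (@le_trans _ _ (v1 ** v2)).
    apply: ler_pomul.
    - exact: measure_fin_ge0 mm _ _ bD1 D1a.
    - exact: measure_fin_ge0 mm _ _ bV2 V2E.
    - by apply: glb1.1; exists V1.
    - by apply: glb2.1; exists V2.
  (* After moving [d] to the left, [v1 ** v2 - d] is the measure of [(V1 ∩ V2) \ (D1 ∩ D2)]. *)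
  rewrite addrA -pov_lerBlDr.
  suff : mu ((V1 `&` V2) `\` (D1 `&` D2)) <= mu (V1 `\` D1) + mu (V2 `\` D2).
    by rewrite E E1 E2.
  apply: le_trans (measure_subadditive mm _ _ b1 b2).
  apply: (measure_mono mm); [exact: borelD|exact: borelU|].
  move=> x [[V1x V2x] nD]; have [D1x|] := pselect (D1 x); last by left.
  by right; split=> // D2x; exact: nD.
(* The infimum over [v1] removes the first excess: [key], rearranged, exhibits a lower bound of the
   values [v1], which is therefore at most [a1]. *)
have key2 v2 : open_measures (mu := mu) D2 v2 -> a1 ** a2 <= (v2 - a2) + d.
  move=> v2E; have : a1 ** a2 - ((v2 - a2) + d) + a1 <= a1.
    apply: glb1.2 => v1 v1E; rewrite -pov_lerBrDr pov_lerBlDr; exact: key.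
  by rewrite -{3}[a1]add0r pov_leD2rE pov_lerBlDr add0r.
(* The infimum over [v2] removes the remaining excess in the same way. *)
have : a1 ** a2 - d + a2 <= a2.
  apply: glb2.2 => v2 v2E; rewrite -pov_lerBrDr pov_lerBlDr; exact: key2.
by rewrite -{3}[a2]add0r pov_leD2rE pov_lerBlDr add0r.
Qed.

End PositiveHomomorphisms.

Theorem theorem3p6 (R : realType) (X : topologicalType) (A : poAlgType R)
    (mu : set X -> adjoin_infty A) (pi : (X -> R) -> A)
    (X_hausdorff : hausdorff_space X)
    (X_locally_compact : locally_compact [set: X])
    (A_complete : monotone_complete A)
    (A_mul_continuous : monotone_continuous_mul A)
    (mu_regular : regular_borel_measure mu)
    (pi_hom : positive_alg_hom pi) :
  ((forall (V : set X) (a : A), open V -> mu V = Fin a ->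
      supremums [set pi f | f in [set f | prec_set f V]] a) ->
    spectral_measure mu)
  /\
  ((forall (K : set X) (a : A), compact K -> mu K = Fin a ->
      infimums [set pi f | f in [set f | set_prec K f]] a) ->
    (forall D : set X, borel D -> finite_measure_at mu D ->
      inner_regular_at mu D) ->
    spectral_measure mu).
Proof.
split=> [mu_open|mu_compact _].
  exact: spectral_of_open pi_hom A_mul_continuous mu_regular mu_open.
apply: (spectral_of_open pi_hom A_mul_continuous mu_regular) => V a oV Va.
have mm := rbm_measure mu_regular; split.
  move=> _ [f [cf f01 fV] <-]; have [b Kb] := rbm_compact_finite mu_regular cf.2.
  have bK : borel (supp f) by apply: borel_closed; exact: closed_closure.
  apply: (@le_trans _ _ b).
    (* As [b] is an infimum, it suffices that each [g] equal to 1 on the support of [f] dominates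
       [f]: there [f <= 1 = g], and elsewhere [f = 0 <= g]. *)
    apply: (mu_compact _ _ cf.2 Kb).2 => _ [g [cg g01 g1] <-].
    apply: pi_mono => // x; have [->|/eqP fx] := eqVneq (f x) 0.
      by have /andP[] := g01 x.
    rewrite g1; first by have /andP[] := f01 x.
    by apply: subset_closure; exact/eqP.
  by have := measure_mono mm _ _ bK (borel_open _ oV) fV; rewrite Kb Va.
(* Inner regularity at [V] reduces the claim [a <= c] to [mu K <= c] for compact [K] inside [V]. *)
move=> c cub; have [_ lub] := rbm_inner_open mu_regular oV.
have := lub (Fin c); rewrite Va; apply => _ [K [cK KV] <-].
have [b Kb] := rbm_compact_finite mu_regular cK; rewrite Kb.
have [f [pf Kf]] := locally_compact_urysohn (R := R) _ _ X_hausdorff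
  X_locally_compact cK oV KV.
apply: (@le_trans _ _ (pi f) b c); last by apply: cub; exists f.
by apply: (mu_compact _ _ cK Kb).1; exists f.
Qed.
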